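(* Let $F$ be an anti-invariant Riemannian submersion from a Kenmotsu manifold $M(\phi,\xi,\eta,g_M)$ to a Riemannian manifold $(N,g_N)$ such that the characteristic vector field $\xi$ is horizontal. Then the following assertions are equivalent to each other: (i) $(\ker F_* )^\perp$ is integrable; (ii) $g_N((\nabla F_* )(Y,BX),F_*\phi V)=g_N((\nabla F_* )(X,BY),F_*\phi V)+g_M(CY,\phi\mathcal{A}_XV)-g_M(CX,\phi\mathcal{A}_YV)$ for all $X,Y\in\Gamma((\ker F_* )^\perp)$ and $V\in\Gamma(\ker F_* )$; (iii) $g_M(\mathcal{A}_XBY-\mathcal{A}_YBX,\phi V)=g_M(CY,\phi\mathcal{A}_XV)-g_M(CX,\phi\mathcal{A}_YV)$ for all $X,Y\in\Gamma((\ker F_* )^\perp)$ and $V\in\Gamma(\ker F_* )$.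
   Context: An almost contact metric structure $(\phi,\xi,\eta,g)$ on a connected $(2m+1)$-dimensional differentiable manifold $M$ consists of a $(1,1)$-tensor field $\phi$, a vector field $\xi$ (the characteristic vector field), a $1$-form $\eta$ and a Riemannian metric $g$ with $\phi^2=-I+\eta\otimes\xi$, $\phi\xi=0$, $\eta\circ\phi=0$, $\eta(\xi)=1$, $g(\phi X,\phi Y)=g(X,Y)-\eta(X)\eta(Y)$, $g(\phi X,Y)+g(X,\phi Y)=0$ and $\eta(X)=g(X,\xi)$ for all vector fields $X,Y$. It is a Kenmotsu manifold if $(\nabla_X\phi)Y=g(\phi X,Y)\xi-\eta(Y)\phi X$ for all $X,Y$, with $\nabla$ the Levi-Civita connection of $g$. A Riemannian submersion $F:(M,g_M)\to(N,g_N)$ is a smooth surjective map of maximal rank (i.e. $F_*$ is surjective at every point) such that $F_*$ preserves the lengths of horizontal vectors; vertical vectors are those in $\ker F_*$, horizontal vectors those in $(\ker F_* )^\perp$, and $\mathcal{V},\mathcal{H}$ denote the orthogonal projections onto these distributions. It is anti-invariant if $\phi(\ker F_* )\subseteq(\ker F_* )^\perp$. Let $\mu$ be the orthogonal complement of $\phi(\ker F_* )$ in $(\ker F_* )^\perp$. For horizontal $X$ write $\phi X=BX+CX$ with $BX\in\Gamma(\ker F_* )$ and $CX\in\Gamma(\mu)$ (so $BX,CX$ are the vertical and horizontal parts of $\phi X$). O'Neill's tensor $\mathcal{A}$ is $\mathcal{A}_EG=\mathcal{V}\nabla_{\mathcal{H}E}\mathcal{H}G+\mathcal{H}\nabla_{\mathcal{H}E}\mathcal{V}G$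 for vector fields $E,G$ on $M$, with $\nabla$ the Levi-Civita connection of $g_M$. The second fundamental form of $F$ is $(\nabla F_* )(X,Y)=\nabla^F_XF_*(Y)-F_*(\nabla_XY)$, where $\nabla^F$ is the pullback connection on $F^{-1}TN$. *)

(* Defs.v *)
From HB Require Import structures.
From mathcomp Require Import all_boot all_order all_algebra.
From mathcomp Require Import boolp classical_sets cardinality functions reals.
From mathcomp Require Import topology normedtype derive.

Set Implicit Arguments.
Unset Strict Implicit.
Unset Printing Implicit Defensive.

Import Order.TTheory GRing.Theory Num.Theory.
Import numFieldNormedType.Exports.
Local Open Scope classical_set_scope.
Local Open Scope ring_scope.

(* Meaningful for open U only: differentiable and 'D_v are computed in the    *)
(* ambient space.                                                            *)
Fixpoint Ck_on (R : realType) (n : nat) (W : normedModType R) (k : nat)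
    (U : set 'rV[R]_n) (f : 'rV[R]_n -> W) : Prop :=
  match k with
  | 0 => forall x, U x -> {for x, continuous f}
  | k'.+1 => (forall x, U x -> differentiable f x) /\
             (forall v, Ck_on k' U (fun x => 'D_v f x))
  end.

Definition smooth_on (R : realType) (n : nat) (W : normedModType R)
    (U : set 'rV[R]_n) (f : 'rV[R]_n -> W) : Prop :=
  forall k, Ck_on k U f.

Record chart (R : realType) (n : nat) (T : topologicalType) := Chart {
  cdom : set T;
  cimg : set 'rV[R]_n;
  cmap : T -> 'rV[R]_n;
  cinv : 'rV[R]_n -> T;
  cdom_open : open cdom;
  cimg_open : open cimg;
  cmap_img : forall p, cdom p -> cimg (cmap p);
  cinv_dom : forall x, cimg x -> cdom (cinv x);
  cmapK : forall p, cdom p -> cinv (cmap p) = p;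
  cinvK : forall x, cimg x -> cmap (cinv x) = x;
  cmap_cont : forall p, cdom p -> {for p, continuous cmap};
  cinv_cont : forall x, cimg x -> {for x, continuous cinv} }.

(* An n-dimensional manifold, given by an atlas (chart_at p)_p which comes    *)
(* with a chosen chart around each point. From an arbitrary atlas one gets    *)
(* such a family, with the same smooth structure, by choosing around each     *)
(* point one of its charts.                                                  *)
Record manifold (R : realType) (n : nat) := Manifold {
  carrier :> topologicalType;
  chart_at : carrier -> chart R n carrier;
  mem_chart_at : forall p, cdom (chart_at p) p;
  transition_smooth : forall p q,
    smooth_on (cimg (chart_at p) `&`
                 cinv (chart_at p) @^-1` cdom (chart_at q))
              (cmap (chart_at q) \o cinv (chart_at p));
  manifold_hausdorff : hausdorff_space carrier;
  manifold_second_countable : @second_countable carrier }.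

(* The tangent space T_pM is 'rV[R]_n: a tangent vector at p is represented   *)
(* by its components with respect to the coordinate basis at p of the chart   *)
(* chart_at p. Linear maps act on row vectors by multiplication on the right. *)
Definition vfield (R : realType) (n : nat) (M : manifold R n) :=
  M -> 'rV[R]_n.

Section Manifold.
Variables (R : realType) (n : nat) (M : manifold R n).

(* At the point q, turns components in the chart chart_at a into components   *)
(* in chart_at b. Hence chart_change q b q expresses a vector of T_qM in the  *)
(* chart around b, and the rows of chart_change a q q are the coordinate      *)
(* vector fields of the chart around a, as elements of T_qM.                  *)
Definition chart_change (a b q : M) : 'M[R]_n :=
  'J (cmap (chart_at b) \o cinv (chart_at a)) (cmap (chart_at a) q).

Definition smooth_fun (f : M -> R) : Prop :=
  forall a, smooth_on (cimg (chart_at a)) (f \o cinv (chart_at a)).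

Definition vf_coord (X : vfield M) (a : M) (x : 'rV[R]_n) : 'rV[R]_n :=
  let q := cinv (chart_at a) x in X q *m chart_change q a q.

Definition smooth_vf (X : vfield M) : Prop :=
  forall a, smooth_on (cimg (chart_at a)) (vf_coord X a).

(* For tensor fields smoothness means that the components in every chart are  *)
(* smooth. A 1-form is given by the column vectors eta p, with value          *)
(* u *m eta p at u; a (1,1)-tensor field by matrices phi p, sending u to      *)
(* u *m phi p; a (0,2)-tensor field by its Gram matrices g p.                 *)
Definition smooth_form (eta : M -> 'cV[R]_n) : Prop :=
  forall a, smooth_on (cimg (chart_at a)) (fun x =>
    let q := cinv (chart_at a) x in chart_change a q q *m eta q).

Definition smooth_endo (phi : M -> 'M[R]_n) : Prop :=
  forall a, smooth_on (cimg (chart_at a)) (fun x =>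
    let q := cinv (chart_at a) x in
    chart_change a q q *m phi q *m chart_change q a q).

Definition smooth_bilin (g : M -> 'M[R]_n) : Prop :=
  forall a, smooth_on (cimg (chart_at a)) (fun x =>
    let q := cinv (chart_at a) x in
    chart_change a q q *m g q *m (chart_change a q q)^T).

Definition form (eta : M -> 'cV[R]_n) (p : M) (u : 'rV[R]_n) : R :=
  (u *m eta p) 0 0.

Definition endo (phi : M -> 'M[R]_n) (X : vfield M) : vfield M :=
  fun p => X p *m phi p.

Definition inner (g : M -> 'M[R]_n) (p : M) (u v : 'rV[R]_n) : R :=
  (u *m g p *m v^T) 0 0.

Record riemannian_metric (g : M -> 'M[R]_n) : Prop := RiemannianMetric {
  metric_smooth : smooth_bilin g;
  metric_sym : forall p u v, inner g p u v = inner g p v u;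
  metric_pos : forall p u, u != 0 -> 0 < inner g p u u }.

Definition vf_scale (f : M -> R) (X : vfield M) : vfield M :=
  fun p => f p *: X p.

Definition vf_app (X : vfield M) (f : M -> R) : M -> R := fun p =>
  'D_(X p) (f \o cinv (chart_at p)) (cmap (chart_at p) p).

(* [X, Y]^i = X^j d_j Y^i - Y^j d_j X^i, computed at p in chart_at p. *)
Definition lie_bracket (X Y : vfield M) : vfield M := fun p =>
  'D_(X p) (vf_coord Y p) (cmap (chart_at p) p) -
  'D_(Y p) (vf_coord X p) (cmap (chart_at p) p).

(* Only the values of nabla on smooth vector fields are constrained. *)
Record affine_connection (nabla : vfield M -> vfield M -> vfield M) : Prop :=
  AffineConnection {
  conn_smooth : forall X Y, smooth_vf X -> smooth_vf Y ->
    smooth_vf (nabla X Y);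
  conn_addl : forall X X' Y, smooth_vf X -> smooth_vf X' -> smooth_vf Y ->
    nabla (X \+ X') Y = nabla X Y \+ nabla X' Y;
  conn_scalel : forall f X Y, smooth_fun f -> smooth_vf X -> smooth_vf Y ->
    nabla (vf_scale f X) Y = vf_scale f (nabla X Y);
  conn_addr : forall X Y Y', smooth_vf X -> smooth_vf Y -> smooth_vf Y' ->
    nabla X (Y \+ Y') = nabla X Y \+ nabla X Y';
  conn_leibniz : forall f X Y, smooth_fun f -> smooth_vf X -> smooth_vf Y ->
    nabla X (vf_scale f Y) =
      vf_scale (vf_app X f) Y \+ vf_scale f (nabla X Y) }.

Record levi_civita (g : M -> 'M[R]_n)
    (nabla : vfield M -> vfield M -> vfield M) : Prop := LeviCivita {
  lc_connection : affine_connection nabla;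
  lc_torsion_free : forall X Y, smooth_vf X -> smooth_vf Y ->
    nabla X Y \- nabla Y X = lie_bracket X Y;
  lc_metric : forall X Y Z, smooth_vf X -> smooth_vf Y -> smooth_vf Z ->
    forall p, vf_app X (fun q => inner g q (Y q) (Z q)) p =
      inner g p (nabla X Y p) (Z p) + inner g p (Y p) (nabla X Z p) }.

(* A distribution D is given by matrices D p, the subspace of T_pM being the  *)
(* row space of D p.                                                         *)
Definition section_of (D : M -> 'M[R]_n) (X : vfield M) : Prop :=
  smooth_vf X /\ forall p, (X p <= D p)%MS.

(* Integrability is taken in its Lie bracket form (as in Spivak and Warner),  *)
(* not as the existence of an integral manifold through every point.         *)
Definition integrable_distribution (D : M -> 'M[R]_n) : Prop :=
  forall X Y, section_of D X -> section_of D Y ->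
  forall p, (lie_bracket X Y p <= D p)%MS.

(* The row space of orth_compl g p A is {u | g_p(u, v) = 0 for all v in A}.   *)
Definition orth_compl (g : M -> 'M[R]_n) (p : M) (A : 'M[R]_n) : 'M[R]_n :=
  kermx (g p *m A^T).

Record almost_contact_metric (phi : M -> 'M[R]_n) (xi : vfield M)
    (eta : M -> 'cV[R]_n) (g : M -> 'M[R]_n) : Prop := AlmostContactMetric {
  acm_phi_smooth : smooth_endo phi;
  acm_xi_smooth : smooth_vf xi;
  acm_eta_smooth : smooth_form eta;
  acm_metric : riemannian_metric g;
  acm_phi2 : forall p u,
    u *m phi p *m phi p = - u + form eta p u *: xi p;
  acm_phi_xi : forall p, xi p *m phi p = 0;
  acm_eta_phi : forall p u, form eta p (u *m phi p) = 0;
  acm_eta_xi : forall p, form eta p (xi p) = 1;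
  acm_compat : forall p u v,
    inner g p (u *m phi p) (v *m phi p) =
      inner g p u v - form eta p u * form eta p v;
  acm_skew : forall p u v,
    inner g p (u *m phi p) v + inner g p u (v *m phi p) = 0;
  acm_eta_g : forall p u, form eta p u = inner g p u (xi p) }.

(* kenmotsu_nabla is the identity                                            *)
(*   (nabla_X phi) Y = g(phi X, Y) xi - eta(Y) phi X,                         *)
(* where (nabla_X phi) Y = nabla_X (phi Y) - phi (nabla_X Y).                 *)
Record kenmotsu (phi : M -> 'M[R]_n) (xi : vfield M) (eta : M -> 'cV[R]_n)
    (g : M -> 'M[R]_n) (nabla : vfield M -> vfield M -> vfield M) : Prop :=
  Kenmotsu {
  kenmotsu_acm : almost_contact_metric phi xi eta g;
  kenmotsu_lc : levi_civita g nabla;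
  kenmotsu_nabla : forall X Y, smooth_vf X -> smooth_vf Y -> forall p,
    nabla X (endo phi Y) p - endo phi (nabla X Y) p =
      inner g p (endo phi X p) (Y p) *: xi p -
      form eta p (Y p) *: endo phi X p }.

End Manifold.

(* Sections of the pullback bundle F^{-1} TN: s p lies in T_{F p}N. *)
Definition vfield_along (R : realType) (n k : nat) (M : manifold R n)
    (N : manifold R k) (F : M -> N) := M -> 'rV[R]_k.

Section Submersion.
Variables (R : realType) (n k : nat) (M : manifold R n) (N : manifold R k).
Variable F : M -> N.

Definition chart_preimage (a : M) (b : N) : set 'rV[R]_n :=
  cimg (chart_at a) `&` [set x | cdom (chart_at b) (F (cinv (chart_at a) x))].

Definition smooth_map : Prop :=
  continuous F /\
  forall a b, smooth_on (chart_preimage a b)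
                (cmap (chart_at b) \o F \o cinv (chart_at a)).

(* F_* : T_pM -> T_{F p}N is u |-> u *m dmap p. *)
Definition dmap (p : M) : 'M[R]_(n, k) :=
  'J (cmap (chart_at (F p)) \o F \o cinv (chart_at p)) (cmap (chart_at p) p).

Definition smooth_along (s : vfield_along F) : Prop :=
  forall a b, smooth_on (chart_preimage a b) (fun x =>
    let q := cinv (chart_at a) x in s q *m chart_change (F q) b (F q)).

Definition push (X : vfield M) : vfield_along F := fun p => X p *m dmap p.

Definition along_scale (f : M -> R) (s : vfield_along F) : vfield_along F :=
  fun p => f p *: s p.

(* The pullback connection is the unique connection on F^{-1} TN for which   *)
(* nabla^F_X (Z o F) = nabla^N_{F_* X} Z. In pbc_pullback the vector field W *)
(* only serves to write the tangent vector F_* (X p) as the value at F p of   *)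
(* a vector field on N.                                                      *)
Record pullback_connection (nablaN : vfield N -> vfield N -> vfield N)
    (nablaF : vfield M -> vfield_along F -> vfield_along F) : Prop :=
  PullbackConnection {
  pbc_smooth : forall X s, smooth_vf X -> smooth_along s ->
    smooth_along (nablaF X s);
  pbc_addl : forall X X' s, smooth_vf X -> smooth_vf X' -> smooth_along s ->
    nablaF (X \+ X') s = nablaF X s \+ nablaF X' s;
  pbc_scalel : forall f X s, smooth_fun f -> smooth_vf X -> smooth_along s ->
    nablaF (vf_scale f X) s = along_scale f (nablaF X s);
  pbc_addr : forall X s s', smooth_vf X -> smooth_along s ->
    smooth_along s' -> nablaF X (s \+ s') = nablaF X s \+ nablaF X s';
  pbc_leibniz : forall f X s, smooth_fun f -> smooth_vf X -> smooth_along s ->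
    nablaF X (along_scale f s) =
      along_scale (vf_app X f) s \+ along_scale f (nablaF X s);
  pbc_pullback : forall X W Z p, smooth_vf X -> smooth_vf W -> smooth_vf Z ->
    push X p = W (F p) -> nablaF X (Z \o F) p = nablaN W Z (F p) }.

Definition second_fundamental_form
    (nabla : vfield M -> vfield M -> vfield M)
    (nablaF : vfield M -> vfield_along F -> vfield_along F)
    (X Y : vfield M) : vfield_along F :=
  nablaF X (push Y) \- push (nabla X Y).

(* kermx is the left kernel: the row space of vert p is the kernel of F_*. *)
Definition vert (p : M) : 'M[R]_n := kermx (dmap p).

Definition hor (gM : M -> 'M[R]_n) (p : M) : 'M[R]_n :=
  orth_compl gM p (vert p).

Record riemannian_submersion (gM : M -> 'M[R]_n) (gN : N -> 'M[R]_k) : Prop :=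
  RiemannianSubmersion {
  rsub_smooth : smooth_map;
  rsub_surj : forall y, exists x, F x = y;
  rsub_rank : forall p, row_full (dmap p);
  rsub_isometry : forall p u, (u <= hor gM p)%MS ->
    inner gN (F p) (u *m dmap p) (u *m dmap p) = inner gM p u u }.

Definition anti_invariant (phi gM : M -> 'M[R]_n) : Prop :=
  forall p (u : 'rV[R]_n), (u <= vert p)%MS -> (u *m phi p <= hor gM p)%MS.

Definition Vproj (gM : M -> 'M[R]_n) (E : vfield M) : vfield M :=
  fun p => E p *m proj_mx (vert p) (hor gM p).

Definition Hproj (gM : M -> 'M[R]_n) (E : vfield M) : vfield M :=
  fun p => E p *m proj_mx (hor gM p) (vert p).

Definition Bpart (gM phi : M -> 'M[R]_n) (X : vfield M) : vfield M :=
  Vproj gM (endo phi X).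

Definition Cpart (gM phi : M -> 'M[R]_n) (X : vfield M) : vfield M :=
  Hproj gM (endo phi X).

Definition oneillA (gM : M -> 'M[R]_n)
    (nabla : vfield M -> vfield M -> vfield M) (E G : vfield M) : vfield M :=
  Vproj gM (nabla (Hproj gM E) (Hproj gM G)) \+
  Hproj gM (nabla (Hproj gM E) (Vproj gM G)).

End Submersion.

(* Main.v *)
Require Import Defs.
From HB Require Import structures.
From mathcomp Require Import all_boot all_order all_algebra.
From mathcomp Require Import boolp classical_sets cardinality functions reals.
From mathcomp Require Import topology normedtype derive.
From mathcomp Require Import landau lra.

Import Order.TTheory GRing.Theory Num.Theory.
Import numFieldNormedType.Exports.
Local Open Scope classical_set_scope.
Local Open Scope ring_scope.

Set Implicit Arguments.
Unset Strict Implicit.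
Unset Printing Implicit Defensive.

(** Write <u, v> for g_M(u, v). The theorem rests on one identity: for X, Y
    horizontal and V vertical,

      <nabla_X Y, V> = <A_X (BY), phi V> - <CY, phi (A_X V)>.

    As eta V = <V, xi> = 0, the compatibility of phi with g_M gives
    <nabla_X Y, V> = <phi (nabla_X Y), phi V>, and the Kenmotsu equation turns
    phi (nabla_X Y) into nabla_X (phi Y), the correction terms being orthogonal
    to phi V. Split phi Y = BY + CY. As phi V is horizontal, the BY term is
    <A_X (BY), phi V>. As CY is orthogonal to phi (ker F_* ), differentiating
    <CY, phi V> = 0 along X moves the derivative from CY to phi V, and a second
    use of the Kenmotsu equation rewrites nabla_X (phi V) as phi (nabla_X V), of
    which only phi (A_X V) is seen by CY (inner_nabla_vert).

    Antisymmetrised in X and Y, the identity says that <[X, Y], V> is the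
    difference of the two sides of (iii), by vanishing torsion
    (inner_lie_bracket_vert). Hence (i) is equivalent to (iii) once
    integrability can be tested against smooth vertical fields. The vertical part
    of [X, Y] is itself such a field and suffices as a test: if [X, Y] is
    orthogonal to it, then that part has norm 0 (integrable_horP). As
    F_* (BX) = 0, the second fundamental form is
    (nabla F_* )(Y, BX) = - F_* (nabla_Y (BX)), so (ii) is (iii) read through
    the isometry F_* on horizontal vectors (inner_sff_vert).

    All of this applies nabla to fields such as BX, CX and phi V, where V may be
    the vertical part of [X, Y], so it needs them to be smooth, and the
    substantial part of the proof is that the horizontal projection is a smooth
    tensor field (smooth_hproj). If D is the matrix of F_* and g the Gram
    matrix of g_M, both in coordinates, then this projection is

      D (D^T g^-1 D)^-1 D^T g^-1,

    which is a rational expression in smooth functions. The formula is natural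
    under changes of coordinates on both sides (hproj_mx_basechange), so it can
    be evaluated in any pair of charts, where D is a Jacobian matrix by the
    chain rule (dmap_charts). *)

(** * Calculus of smooth functions on open sets of R^n *)

(** The difference of f and g vanishes near x, so its differential there
    is 0. *)
Lemma near_eq_differentiable (R : realType) (V W : normedModType R)
    (f g : V -> W) (x : V) :
  (\near x, f x = g x) -> differentiable f x -> differentiable g x.
Proof.
move=> fg df.
have dh : differentiable (g - f) x.
  have h0 : (g - f) \o shift x = cst ((g - f) x) + (\0 : V -> W) +o_ 0 id.
    apply/eqaddoP => e e0; near=> y.
    have fgy : f (y + x) = g (y + x).
      near: y; move: fg; rewrite (near_shift 0) /=.
      by apply: filterS => z /=; rewrite subr0.
    rewrite !fctE /= fgy (nbhs_singleton fg) !subrr.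
    by rewrite addr0 subr0 normr0 mulr_ge0 // ltW.
  have c0 : continuous (\0 : V -> W) by exact: cst_continuous.
  have d0 := diff_unique c0 h0.
  by apply/diff_locallyP; rewrite d0.
by have := differentiableD df dh; rewrite addrC subrK.
Unshelve. all: by end_near. Qed.

Section SmoothCalculus.
Variables (R : realType) (n : nat).
Implicit Types (U : set 'rV[R]_n) (W : normedModType R).

Lemma open_near W U (f g : 'rV[R]_n -> W) x :
  open U -> (forall y, U y -> f y = g y) -> U x -> \near x, f x = g x.
Proof. by move=> oU fg Ux; near=> y; apply: fg; near: y; exact: open_nbhs_nbhs.
Unshelve. all: by end_near. Qed.

Lemma Ck_on_ext W k U (f g : 'rV[R]_n -> W) : open U ->
  (forall x, U x -> f x = g x) -> Ck_on k U f -> Ck_on k U g.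
Proof.
move=> oU; elim: k f g => [|k IH] f g fg /=.
  move=> cf x Ux; have nfg := open_near oU fg Ux.
  have cfx : f @ x --> f x by exact: cf.
  rewrite (fg _ Ux) in cfx; apply: cvg_trans cfx.
  exact: near_eq_cvg nfg.
move=> [df cf]; split=> [x Ux|v].
  exact: near_eq_differentiable (open_near oU fg Ux) (df x Ux).
apply: IH (cf v) => x Ux.
exact: near_eq_derive (open_near oU fg Ux).
Qed.

Lemma Ck_on_subset W k U U' (f : 'rV[R]_n -> W) :
  U' `<=` U -> Ck_on k U f -> Ck_on k U' f.
Proof.
move=> sU; elim: k f => [|k IH] f /=; first by move=> cf x /sU; apply: cf.
by move=> [df cf]; split=> [x /sU|v]; [apply: df|apply: IH].
Qed.

Lemma Ck_on_local W k U (f : 'rV[R]_n -> W) :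
  (forall x, U x -> exists2 U', U' x & Ck_on k U' f) -> Ck_on k U f.
Proof.
elim: k f => [|k IH] f /= loc.
  by move=> x Ux; have [U' U'x] := loc x Ux; apply.
split=> [x Ux|v]; first by have [U' U'x [+ _]] := loc x Ux; apply.
by apply: IH => x Ux; have [U' U'x [_ cf]] := loc x Ux; exists U'.
Qed.

(** For k = 0 this is the continuity of differentiable functions; it is
    what makes the Leibniz rule usable in the induction on k for products. *)
Lemma Ck_on_pred W k U (f : 'rV[R]_n -> W) : Ck_on k.+1 U f -> Ck_on k U f.
Proof.
elim: k f => [|k IH] f.
  by move=> [df _] x Ux; apply: differentiable_continuous; apply: df.
by move=> [df cf]; split=> // v; apply: IH.
Qed.

Lemma Ck_on_cst W k U (a : W) : Ck_on k U (cst a).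
Proof.
elim: k a => [|k IH] a /=; first by move=> x _; exact: cst_continuous.
split=> [x _|v]; first exact: differentiable_cst.
rewrite (_ : (fun x => _) = cst 0) //.
by apply/funext => x; rewrite derive_cst.
Qed.

Lemma Ck_onD W k U (f g : 'rV[R]_n -> W) : open U ->
  Ck_on k U f -> Ck_on k U g -> Ck_on k U (f \+ g).
Proof.
move=> oU; elim: k f g => [|k IH] f g /=.
  by move=> cf cg x Ux; apply: continuousD; [apply: cf|apply: cg].
move=> [df cf] [dg cg]; split=> [x Ux|v].
  by apply: differentiableD; [apply: df|apply: dg].
apply: Ck_on_ext (IH _ _ (cf v) (cg v)) => // x Ux /=.
by rewrite deriveD //; apply: diff_derivable; [apply: df|apply: dg].
Qed.

Lemma Ck_on_linear W W' k U (L : {linear W -> W'}) (f : 'rV[R]_n -> W) :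
  open U -> continuous L -> Ck_on k U f -> Ck_on k U (L \o f).
Proof.
move=> oU cL; elim: k f => [|k IH] f /=.
  by move=> cf x Ux; apply: continuous_comp; [apply: cf|exact: cL].
move=> [df cf]; have dL y : differentiable L y by exact: linear_differentiable.
split=> [x Ux|v]; first by apply: differentiable_comp => //; apply: df.
apply: Ck_on_ext (IH _ (cf v)) => // x Ux /=.
have dfx := df x Ux.
rewrite (deriveE _ dfx) (deriveE _ (differentiable_comp dfx (dL _))).
by rewrite (diff_comp dfx (dL _)) /= (diff_lin _ cL).
Qed.

(** By induction on k: the derivative f dg + g df pairs a function of
    class C^k.+1, hence C^k, with one of class C^k. *)
Lemma Ck_onM k U (f g : 'rV[R]_n -> R) : open U ->
  Ck_on k U f -> Ck_on k U g -> Ck_on k U (f \* g).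
Proof.
move=> oU; elim: k f g => [|k IH] f g.
  by move=> cf cg x Ux; apply: continuousM; [apply: cf|apply: cg].
move=> Cf Cg; have [df cf] := Cf; have [dg cg] := Cg; split=> [x Ux|v].
  by apply: differentiableM; [apply: df|apply: dg].
have H := Ck_onD oU (IH _ _ (Ck_on_pred Cf) (cg v))
                    (IH _ _ (Ck_on_pred Cg) (cf v)).
apply: Ck_on_ext H => // x Ux /=.
by rewrite deriveM //; apply: diff_derivable; [apply: df|apply: dg].
Qed.

(** The derivative - f^-2 df of 1 / f again involves 1 / f, to which the
    induction hypothesis on k applies. *)
Lemma Ck_onV k U (f : 'rV[R]_n -> R) : open U -> (forall x, U x -> f x != 0) ->
  Ck_on k U f -> Ck_on k U (fun x => (f x)^-1).
Proof.
move=> oU f0; elim: k => [|k IH].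
  by move=> cf x Ux; apply: continuousV; [exact: f0|apply: cf].
move=> Cf; have [df cf] := Cf; split=> [x Ux|v].
  by apply: differentiableV; [apply: df|apply: f0].
have Ci := IH (Ck_on_pred Cf).
have H := Ck_onM oU (Ck_on_cst k U (-1 : R))
                    (Ck_onM oU (Ck_onM oU Ci Ci) (cf v)).
apply: Ck_on_ext H => // x Ux /=.
rewrite deriveV ?f0 //; last by apply: diff_derivable; apply: df.
by rewrite mulN1r scaleNr expr2 invfM.
Qed.


Lemma smooth_on_ext W U (f g : 'rV[R]_n -> W) : open U ->
  (forall x, U x -> f x = g x) -> smooth_on U f -> smooth_on U g.
Proof. by move=> oU fg sf k; exact: Ck_on_ext fg (sf k). Qed.

Lemma eq_smooth_on W U (f g : 'rV[R]_n -> W) :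
  f =1 g -> smooth_on U f -> smooth_on U g.
Proof. by move=> /funext ->. Qed.

Lemma smooth_on_local W U (f : 'rV[R]_n -> W) :
  (forall x, U x -> exists2 U', U' x & smooth_on U' f) -> smooth_on U f.
Proof.
move=> loc k; apply: Ck_on_local => x /loc[U' U'x sf].
by exists U'; last exact: sf.
Qed.

Lemma smooth_onD W U (f g : 'rV[R]_n -> W) : open U ->
  smooth_on U f -> smooth_on U g -> smooth_on U (f \+ g).
Proof. by move=> oU sf sg k; apply: Ck_onD. Qed.

Lemma smooth_on_cst W U (a : W) : smooth_on U (cst a).
Proof. by move=> k; apply: Ck_on_cst. Qed.

Lemma smooth_on_sum W U I (r : seq I) (P : pred I) (F : I -> 'rV[R]_n -> W) :
  open U -> (forall i, P i -> smooth_on U (F i)) ->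
  smooth_on U (fun x => \sum_(i <- r | P i) F i x).
Proof.
move=> oU sF; elim: r => [|i r IH].
  apply: (eq_smooth_on (f := cst 0)) => [x|]; last exact: smooth_on_cst.
  by rewrite big_nil.
case: (boolP (P i)) => [Pi|/negbTE Pi].
  apply: (eq_smooth_on (f := F i \+ fun x => \sum_(j <- r | P j) F j x)).
    by move=> x; rewrite big_cons Pi.
  by apply: smooth_onD => //; exact: sF.
by apply: eq_smooth_on IH => x; rewrite big_cons Pi.
Qed.

Lemma smooth_on_prod U I (r : seq I) (P : pred I) (F : I -> 'rV[R]_n -> R) :
  open U -> (forall i, P i -> smooth_on U (F i)) ->
  smooth_on U (fun x => \prod_(i <- r | P i) F i x).
Proof.
move=> oU sF; elim: r => [|i r IH].
  apply: (eq_smooth_on (f := cst (1 : R))) => [x|]; last exact: smooth_on_cst.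
  by rewrite big_nil.
case: (boolP (P i)) => [Pi|/negbTE Pi].
  apply: (eq_smooth_on (f := F i \* fun x => \prod_(j <- r | P j) F j x)).
    by move=> x; rewrite big_cons Pi.
  by move=> k; apply: Ck_onM => //; exact: sF.
by apply: eq_smooth_on IH => x; rewrite big_cons Pi.
Qed.

Lemma smooth_on_coord m p U (f : 'rV[R]_n -> 'M[R]_(m, p)) i j : open U ->
  smooth_on U f -> smooth_on U (fun x => f x i j).
Proof.
move=> oU sf k.
have lin : linear (fun A : 'M[R]_(m, p) => A i j : R).
  by move=> a A B; rewrite !mxE.
pose linM := GRing.isLinear.Build _ _ _ _ _ lin.
pose L : {linear _ -> _} := HB.pack (fun A : 'M[R]_(m, p) => A i j : R) linM.
by apply: (@Ck_on_linear _ _ k U L f) => //; exact: coord_continuous.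
Qed.

Lemma smooth_on_mx m p U (f : 'rV[R]_n -> 'M[R]_(m, p)) : open U ->
  (forall i j, smooth_on U (fun x => f x i j)) -> smooth_on U f.
Proof.
move=> oU sf.
have -> : f = fun x => \sum_i \sum_j f x i j *: delta_mx i j.
  by apply/funext => x; exact: matrix_sum_delta.
apply: smooth_on_sum => // i _; apply: smooth_on_sum => // j _ k.
pose d : 'M[R]_(m, p) := delta_mx i j.
have lin : linear (fun r : R => r *: d).
  by move=> a r s; rewrite scalerDl scalerA.
pose linM := GRing.isLinear.Build _ _ _ _ _ lin.
pose L : {linear _ -> _} := HB.pack (fun r : R => r *: d) linM.
apply: (@Ck_on_linear _ _ k U L (fun x => f x i j)) => //; last exact: sf.
exact: scalel_continuous.
Qed.

Lemma smooth_on_mulmx m p q U (f : 'rV[R]_n -> 'M[R]_(m, p))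
    (g : 'rV[R]_n -> 'M[R]_(p, q)) : open U ->
  smooth_on U f -> smooth_on U g -> smooth_on U (fun x => f x *m g x).
Proof.
move=> oU sf sg; apply: smooth_on_mx => // i j.
apply: (eq_smooth_on (f := fun x => \sum_l f x i l * g x l j)) => [x|].
  by rewrite mxE.
apply: smooth_on_sum => // l _ k.
by apply: Ck_onM => //; exact: smooth_on_coord.
Qed.

Lemma smooth_on_tr m p U (f : 'rV[R]_n -> 'M[R]_(m, p)) : open U ->
  smooth_on U f -> smooth_on U (fun x => (f x)^T).
Proof.
move=> oU sf; apply: smooth_on_mx => // i j.
apply: (eq_smooth_on (f := fun x => f x j i)) => [x|]; first by rewrite mxE.
exact: smooth_on_coord.
Qed.

Lemma smooth_on_det m U (f : 'rV[R]_n -> 'M[R]_m) : open U ->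
  (forall i j, smooth_on U (fun x => f x i j)) ->
  smooth_on U (fun x => \det (f x)).
Proof.
move=> oU sf; apply: smooth_on_sum => // s _ k.
apply: Ck_onM => //; first exact: smooth_on_cst.
by apply: smooth_on_prod => // i _; exact: sf.
Qed.

(** Cramer's rule makes the entries of the inverse rational functions,
    with nonvanishing denominator, of those of the matrix. *)
Lemma smooth_on_invmx m U (f : 'rV[R]_n -> 'M[R]_m) : open U ->
  (forall x, U x -> f x \in unitmx) ->
  smooth_on U f -> smooth_on U (fun x => invmx (f x)).
Proof.
move=> oU uf sf; have sfc i j := smooth_on_coord i j oU sf.
apply: (@smooth_on_ext _ _ (fun x => (\det (f x))^-1 *: \adj (f x))) => //.
  by move=> x Ux; rewrite /invmx uf.
apply: smooth_on_mx => // i j.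
apply: (eq_smooth_on
  (f := fun x => (\det (f x))^-1 * cofactor (f x) j i)) => [x|].
  by rewrite !mxE.
move=> k; apply: Ck_onM => //.
  apply: Ck_onV => // [x Ux|]; last exact: smooth_on_det.
  by rewrite -unitfE -unitmxE uf.
rewrite /cofactor; apply: Ck_onM => //; first exact: smooth_on_cst.
apply: smooth_on_det => // i' j'.
apply: (eq_smooth_on (f := fun x => f x (lift j i') (lift i j'))) => [x|].
  by rewrite !mxE.
exact: sfc.
Qed.

(** The rows of the Jacobian matrix are the derivatives along the standard
    basis. *)
Lemma smooth_on_jacobian m U (f : 'rV[R]_n -> 'rV[R]_m) : open U ->
  smooth_on U f -> smooth_on U (fun x => 'J f x).
Proof.
move=> oU sf; apply: smooth_on_mx => // i j.
have dsf : smooth_on U (fun x => 'D_(delta_mx 0 i) f x).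
  by move=> k; have [_] := sf k.+1; apply.
apply: smooth_on_ext (smooth_on_coord 0 j oU dsf) => // x Ux.
have [df _] := sf 1.
by rewrite deriveEjacobian -?rowE ?mxE //; exact: df.
Qed.

Lemma smooth_on_differentiable W U (f : 'rV[R]_n -> W) x :
  smooth_on U f -> U x -> differentiable f x.
Proof. by move=> sf Ux; have [df _] := sf 1; exact: df. Qed.

End SmoothCalculus.

(** * The orthogonal projection as a matrix *)

Lemma invmxM (R : comUnitRingType) n (A B : 'M[R]_n) :
  A \in unitmx -> B \in unitmx -> invmx (A *m B) = invmx B *m invmx A.
Proof.
move=> uA uB; have uAB : A *m B \in unitmx by rewrite unitmx_mul uA.
apply: (can_inj (mulKmx uAB)).
by rewrite mulmxV // mulmxA mulmxK // mulmxV.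
Qed.

Section HorizontalProjection.
Variables (R : realFieldType) (n k : nat).

(** The columns of D span the annihilator of its left kernel; this is
    their Gram matrix for the inverse metric. *)
Definition cogram (g : 'M[R]_n) (D : 'M[R]_(n, k)) : 'M[R]_k :=
  D^T *m invmx g *m D.

(** The orthogonal projection, for g, onto the complement of the left
    kernel of D, acting on row vectors. *)
Definition hproj_mx (g : 'M[R]_n) (D : 'M[R]_(n, k)) : 'M[R]_n :=
  D *m invmx (cogram g D) *m (D^T *m invmx g).

(** C changes the basis of the source of D, so that g becomes C g C^T, and
    K that of its target. *)
Section BaseChange.
Variables (g C : 'M[R]_n) (D : 'M[R]_(n, k)) (K : 'M[R]_k).
Hypotheses (g_unit : g \in unitmx) (C_unit : C \in unitmx).

Let coframe_basechange : (C *m D *m K)^T *m invmx (C *m g *m C^T) =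
  K^T *m (D^T *m invmx g) *m invmx C.
Proof.
have Ct_unit : C^T \in unitmx by rewrite unitmx_tr.
rewrite !invmxM ?unitmx_mul ?C_unit // !trmx_mul !mulmxA.
by rewrite mulmxK.
Qed.

Lemma cogram_basechange :
  cogram (C *m g *m C^T) (C *m D *m K) = K^T *m cogram g D *m K.
Proof. by rewrite /cogram coframe_basechange !mulmxA mulmxKV. Qed.

Lemma hproj_mx_basechange : K \in unitmx -> cogram g D \in unitmx ->
  hproj_mx (C *m g *m C^T) (C *m D *m K) = C *m hproj_mx g D *m invmx C.
Proof.
move=> K_unit G_unit; have Kt_unit : K^T \in unitmx by rewrite unitmx_tr.
rewrite /hproj_mx cogram_basechange coframe_basechange.
rewrite !invmxM ?unitmx_mul ?Kt_unit // !mulmxA mulmxK //.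
by rewrite mulmxKV.
Qed.

End BaseChange.

Variables (g : 'M[R]_n) (D : 'M[R]_(n, k)).
Hypothesis g_sym : g^T = g.
Hypothesis g_pos : forall u : 'rV[R]_n, u != 0 -> 0 < (u *m g *m u^T) 0 0.
Hypothesis D_full : row_full D.

Lemma g_aniso (u : 'rV[R]_n) : u *m g *m u^T = 0 -> u = 0.
Proof.
by move=> u0; apply: contraTeq isT => /g_pos; rewrite u0 mxE ltxx.
Qed.

Lemma metric_unitmx : g \in unitmx.
Proof.
rewrite -row_free_unit; apply: inj_row_free => v vg0.
by apply: g_aniso; rewrite vg0 mul0mx.
Qed.

(** If w kills the matrix then w D^T g^-1 is g-isotropic, hence 0, and D^T
    is injective. *)
Lemma cogram_unitmx : cogram g D \in unitmx.
Proof.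
have ug := metric_unitmx; rewrite /cogram -row_free_unit.
apply: inj_row_free => w w0.
have z0 : w *m D^T *m invmx g = 0.
  apply: g_aniso; rewrite mulmxKV // !trmx_mul trmxK trmx_inv g_sym.
  have := congr1 (fun v => v *m w^T) w0.
  by rewrite mul0mx !mulmxA.
apply: (row_free_inj (A := D^T)); first by rewrite /row_free mxrank_tr.
by rewrite mul0mx -[LHS](mulmxKV ug) z0 mul0mx.
Qed.

Lemma hproj_mx_ker m (u : 'M[R]_(m, n)) : (u - u *m hproj_mx g D <= kermx D)%MS.
Proof.
apply/sub_kermxP; rewrite /hproj_mx mulmxBl -!mulmxA (mulmxA D^T).
by rewrite -/(cogram g D) mulVmx ?cogram_unitmx // mulmx1 subrr.
Qed.

Lemma hproj_mx_orth m (u : 'M[R]_(m, n)) :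
  (u *m hproj_mx g D <= kermx (g *m (kermx D)^T))%MS.
Proof.
apply/sub_kermxP; rewrite /hproj_mx !mulmxA mulmxKV ?metric_unitmx //.
by rewrite -!mulmxA -trmx_mul mulmx_ker trmx0 !mulmx0.
Qed.

Lemma ver_hor_cap : (kermx D :&: kermx (g *m (kermx D)^T) = 0)%MS.
Proof.
apply/eqP/rowV0P => v; rewrite sub_capmx => /andP[/submxP[w vE] /sub_kermxP v0].
apply: g_aniso; rewrite [in v^T]vE trmx_mul -mulmxA (mulmxA g).
by rewrite mulmxA v0 mul0mx.
Qed.

Lemma hor_ver_cap : (kermx (g *m (kermx D)^T) :&: kermx D = 0)%MS.
Proof. by have := ver_hor_cap; rewrite capmxC. Qed.

Lemma ver_hor_add m (u : 'M[R]_(m, n)) :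
  (u <= kermx D + kermx (g *m (kermx D)^T))%MS.
Proof.
rewrite -[u](subrK (u *m hproj_mx g D)).
by rewrite addmx_sub_adds ?hproj_mx_ker ?hproj_mx_orth.
Qed.

(** The projection along a direct sum decomposition is determined by its
    values on the two summands, and u - u P, u P is the decomposition of u. *)
Lemma proj_mx_hproj :
  proj_mx (kermx (g *m (kermx D)^T)) (kermx D) = hproj_mx g D.
Proof.
apply/row_matrixP => i; rewrite !rowE.
move: (delta_mx 0 i) => u; rewrite -[u in LHS](subrK (u *m hproj_mx g D)).
rewrite mulmxDl (proj_mx_0 hor_ver_cap (hproj_mx_ker u)) add0r.
exact: (proj_mx_id hor_ver_cap (hproj_mx_orth u)).
Qed.

End HorizontalProjection.

(** * Charts and smooth fields *)

Section Jacobian.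
Variables (R : realType) (n m : nat).

Lemma near_eq_jacobian (f g : 'rV[R]_n -> 'rV[R]_m) x :
  (\near x, f x = g x) -> differentiable f x -> 'J f x = 'J g x.
Proof.
move=> fg df; have dg := near_eq_differentiable fg df.
have JE (v : 'rV[R]_n) : v *m 'J f x = v *m 'J g x.
  apply: etrans (esym (deriveEjacobian v df)) _.
  by apply: etrans (deriveEjacobian v dg); exact: near_eq_derive.
apply/row_matrixP => i.
by apply: etrans (rowE _ _) _; apply: etrans (JE _) _; apply: esym (rowE _ _).
Qed.

Lemma jacobian_comp p (f : 'rV[R]_n -> 'rV[R]_m) (g : 'rV[R]_m -> 'rV[R]_p) x :
  differentiable f x -> differentiable g (f x) ->
  'J (g \o f) x = 'J f x *m 'J g (f x).
Proof.
move=> df dg; apply/row_matrixP => i; rewrite !rowE mulmxA /jacobian.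
by rewrite !mul_rV_lin1 diff_comp.
Qed.

Lemma jacobian_id (x : 'rV[R]_n) : 'J (@id 'rV[R]_n) x = 1%:M.
Proof.
apply/row_matrixP => i; rewrite !rowE mulmx1.
by rewrite -deriveEjacobian ?derive_id.
Qed.

End Jacobian.

Section Charts.
Variables (R : realType) (n : nat) (M : manifold R n).
Implicit Types (a b c q : M) (X : vfield M).

Lemma chart_preimage_open a (W : set M) :
  open W -> open (cimg (chart_at a) `&` cinv (chart_at a) @^-1` W).
Proof.
move=> oW; rewrite openE => x [ax Wx]; apply: filterI.
  by apply: open_nbhs_nbhs; split=> //; exact: cimg_open.
by apply: (cinv_cont ax); apply: open_nbhs_nbhs; split.
Qed.

Lemma transition_near a b q : cdom (chart_at a) q -> cdom (chart_at b) q ->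
  \forall x \near cmap (chart_at a) q,
    [/\ cimg (chart_at a) x & cdom (chart_at b) (cinv (chart_at a) x)].
Proof.
move=> aq bq; have oU := chart_preimage_open (a := a) (cdom_open (chart_at b)).
have : nbhs (cmap (chart_at a) q)
  (cimg (chart_at a) `&` cinv (chart_at a) @^-1` cdom (chart_at b)).
  apply: open_nbhs_nbhs; split=> //; split; first exact: cmap_img.
  by rewrite /preimage /= cmapK.
by apply: filterS => x [].
Qed.

Lemma transition_differentiable a b q :
  cdom (chart_at a) q -> cdom (chart_at b) q ->
  differentiable (cmap (chart_at b) \o cinv (chart_at a)) (cmap (chart_at a) q).
Proof.
move=> aq bq; apply: smooth_on_differentiable (transition_smooth a b) _.
by split; [exact: cmap_img|rewrite /preimage /= cmapK].
Qed.

(** The chain rule for transition maps, which compose near q. *)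
Lemma chart_changeM a b c q : cdom (chart_at a) q -> cdom (chart_at b) q ->
  cdom (chart_at c) q ->
  chart_change a b q *m chart_change b c q = chart_change a c q.
Proof.
move=> aq bq cq; rewrite /chart_change.
set x := cmap (chart_at a) q.
set f := cmap (chart_at b) \o cinv (chart_at a).
set g := cmap (chart_at c) \o cinv (chart_at b).
have fx : cmap (chart_at b) q = f x by rewrite /f /x /= cmapK.
have df : differentiable f x by exact: transition_differentiable.
have dg : differentiable g (f x).
  by rewrite -fx; exact: transition_differentiable.
rewrite fx; apply: etrans (esym (jacobian_comp df dg)) _.
apply: near_eq_jacobian; last exact: differentiable_comp df dg.
apply: filterS (transition_near aq bq) => y [ay yb].
by rewrite /g /f /= cmapK.
Qed.

Lemma chart_changexx a q : cdom (chart_at a) q -> chart_change a a q = 1%:M.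
Proof.
move=> aq; rewrite /chart_change -(jacobian_id (cmap (chart_at a) q)).
apply: near_eq_jacobian; last exact: transition_differentiable.
by apply: filterS (transition_near aq aq) => x [ax _] /=; rewrite cinvK.
Qed.

Lemma chart_changeK a b q : cdom (chart_at a) q -> cdom (chart_at b) q ->
  chart_change a b q *m chart_change b a q = 1%:M.
Proof. by move=> aq bq; rewrite chart_changeM // chart_changexx. Qed.

Lemma chart_change_unitmx a b q :
  cdom (chart_at a) q -> cdom (chart_at b) q -> chart_change a b q \in unitmx.
Proof. move=> aq bq; exact: (proj1 (mulmx1_unit (chart_changeK aq bq))). Qed.

Lemma invmx_chart_change a b q : cdom (chart_at a) q -> cdom (chart_at b) q ->
  invmx (chart_change a b q) = chart_change b a q.
Proof.
move=> aq bq; have u := chart_change_unitmx aq bq; apply: (can_inj (mulKmx u)).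
by rewrite (mulmxV u) (chart_changeK aq bq).
Qed.

Lemma mulmx_conj (u : 'rV[R]_n) (A B P : 'M[R]_n) : A *m B = 1%:M ->
  (u *m A) *m (B *m P *m A) = (u *m P) *m A.
Proof. by move=> AB; rewrite !mulmxA -(mulmxA u) AB mulmx1. Qed.

(** In a chart the components of phi X are the product of the component
    matrices, because the two changes of coordinates in the middle cancel. *)
Lemma smooth_vf_endo phi X : smooth_endo phi -> smooth_vf X ->
  smooth_vf (endo phi X).
Proof.
move=> sphi sX a; have oa : open (cimg (chart_at a)) by exact: cimg_open.
apply: smooth_on_ext (smooth_on_mulmx oa (sX a) (sphi a)) => // x ax.
rewrite /vf_coord /endo /=; set q := cinv _ x.
have aq : cdom (chart_at a) q by exact: cinv_dom.
have K := chart_changeK (mem_chart_at q) aq.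
exact: mulmx_conj K.
Qed.

Lemma smooth_vf_sub X Y : smooth_vf X -> smooth_vf Y -> smooth_vf (X \- Y).
Proof.
move=> sX sY a; have oa : open (cimg (chart_at a)) by exact: cimg_open.
have sN : smooth_on (cimg (chart_at a)) (fun x => - vf_coord Y a x).
  apply: smooth_on_mx => // i j k.
  have sYij := smooth_on_coord i j oa (sY a).
  apply: Ck_on_ext (Ck_onM oa (Ck_on_cst k _ (-1 : R)) (sYij k)) => // x _.
  by rewrite /= mulN1r [in RHS]mxE.
apply: smooth_on_ext (smooth_onD oa (sX a) sN) => // x _.
by rewrite /vf_coord /= mulmxBl.
Qed.

Lemma smooth_vf0 : smooth_vf (fun _ : M => 0).
Proof.
move=> a; apply: (eq_smooth_on (f := cst 0)); last exact: smooth_on_cst.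
by move=> x; rewrite /vf_coord /= mul0mx.
Qed.

End Charts.

Section SmoothMaps.
Variables (R : realType) (n k : nat) (M : manifold R n) (N : manifold R k).
Variable F : M -> N.
Hypothesis F_smooth : smooth_map F.
Implicit Types (a : M) (b : N).

Lemma preimage_cdom_open b : open (F @^-1` cdom (chart_at b)).
Proof.
by apply: open_comp => [x _|]; [exact: (proj1 F_smooth)|exact: cdom_open].
Qed.

Lemma open_chart_preimage a b : open (chart_preimage F a b).
Proof. exact: (chart_preimage_open (preimage_cdom_open b)). Qed.

(** Near x the coordinate expression of F is the composite of a transition
    map of M, the expression of F in the charts around q and F q that defines
    dmap, and a transition map of N. *)
Lemma dmap_charts a b x : chart_preimage F a b x ->
  let q := cinv (chart_at a) x in
  'J (cmap (chart_at b) \o F \o cinv (chart_at a)) x =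
    chart_change a q q *m dmap F q *m chart_change (F q) b (F q).
Proof.
move=> [ax bx] q; rewrite /= in bx.
have aq : cdom (chart_at a) q by exact: cinv_dom.
have qq := mem_chart_at q; have FF := mem_chart_at (F q).
have xE : x = cmap (chart_at a) q by rewrite cinvK.
rewrite /dmap /chart_change.
set f := cmap (chart_at q) \o cinv (chart_at a).
set h := cmap (chart_at (F q)) \o F \o cinv (chart_at q).
set l := cmap (chart_at b) \o cinv (chart_at (F q)).
have df : differentiable f x by rewrite xE; exact: transition_differentiable.
have fx : f x = cmap (chart_at q) q by [].
have dh : differentiable h (f x).
  rewrite fx; apply: smooth_on_differentiable (proj2 F_smooth q (F q)) _.
  by split; [exact: cmap_img|rewrite /= cmapK].
have hfx : h (f x) = cmap (chart_at (F q)) (F q).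
  by rewrite /h fx /= cmapK.
have dl : differentiable l (h (f x)).
  by rewrite hfx; exact: transition_differentiable.
have dhf : differentiable (h \o f) x by exact: differentiable_comp.
rewrite -xE -fx -hfx -jacobian_comp // -(jacobian_comp dhf dl).
apply/esym/near_eq_jacobian; last exact: differentiable_comp dhf dl.
have near1 := transition_near aq qq; rewrite -xE in near1.
have near2 : nbhs x (chart_preimage F a (F q)).
  by apply: open_nbhs_nbhs; split; [exact: open_chart_preimage|].
near=> y.
have [_ y1] : cimg (chart_at a) y /\ cdom (chart_at q) (cinv (chart_at a) y).
  by near: y; apply: filterS near1 => y [].
have [_ y2] : chart_preimage F a (F q) y by near: y.
by rewrite /l /h /f /= (cmapK y1) (cmapK y2).
Unshelve. all: by end_near. Qed.

Lemma smooth_along0 : smooth_along (F := F) (fun _ => 0).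
Proof.
move=> a b; apply: (eq_smooth_on (f := cst 0)); last exact: smooth_on_cst.
by move=> x; rewrite /= mul0mx.
Qed.

End SmoothMaps.

(** * The horizontal and vertical projections *)

Section Inner.
Variables (R : realType) (n : nat) (M : manifold R n) (g : M -> 'M[R]_n).
Implicit Types (p : M) (u v w : 'rV[R]_n).

Lemma innerDl p u v w : inner g p (u + v) w = inner g p u w + inner g p v w.
Proof. by rewrite /inner !mulmxDl mxE. Qed.

Lemma innerNl p u w : inner g p (- u) w = - inner g p u w.
Proof. by rewrite /inner !mulNmx mxE. Qed.

Lemma innerBl p u v w : inner g p (u - v) w = inner g p u w - inner g p v w.
Proof. by rewrite innerDl innerNl. Qed.

Lemma innerZl p c u w : inner g p (c *: u) w = c * inner g p u w.
Proof. by rewrite /inner -!scalemxAl mxE. Qed.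

Lemma innerDr p u v w : inner g p u (v + w) = inner g p u v + inner g p u w.
Proof. by rewrite /inner linearD /= mulmxDr mxE. Qed.

Lemma innerZr p c u w : inner g p u (c *: w) = c * inner g p u w.
Proof. by rewrite /inner linearZ /= -scalemxAr mxE. Qed.

Hypothesis g_metric : riemannian_metric g.

Lemma metric_symmx p : (g p)^T = g p.
Proof.
apply/matrixP => i j; rewrite mxE.
have := Defs.metric_sym g_metric p (delta_mx 0 j) (delta_mx 0 i).
by rewrite /inner !trmx_delta -!rowE -!colE !mxE.
Qed.

Lemma inner_eq0 p u : inner g p u u = 0 -> u = 0.
Proof.
by move=> u0; apply: contraTeq isT => /(metric_pos g_metric p); rewrite u0 ltxx.
Qed.

End Inner.

Lemma smooth_on_hproj_mx (R : realType) (n m k : nat) (U : set 'rV[R]_n)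
    (g : 'rV[R]_n -> 'M[R]_m) (D : 'rV[R]_n -> 'M[R]_(m, k)) : open U ->
  smooth_on U g -> smooth_on U D -> (forall x, U x -> g x \in unitmx) ->
  (forall x, U x -> cogram (g x) (D x) \in unitmx) ->
  smooth_on U (fun x => hproj_mx (g x) (D x)).
Proof.
move=> oU sg sD ug uG; have sgi := smooth_on_invmx oU ug sg.
have sE := smooth_on_mulmx oU (smooth_on_tr oU sD) sgi.
have sGi := smooth_on_invmx oU uG (smooth_on_mulmx oU sE sD).
exact: smooth_on_mulmx oU (smooth_on_mulmx oU sD sGi) sE.
Qed.

Section Submersion.
Variables (R : realType) (n k : nat) (M : manifold R n) (N : manifold R k).
Variables (F : M -> N) (gM : M -> 'M[R]_n) (gN : N -> 'M[R]_k).
Hypothesis gM_metric : riemannian_metric gM.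
Hypothesis gN_metric : riemannian_metric gN.
Hypothesis F_sub : riemannian_submersion F gM gN.
Implicit Types (p : M) (u v w : 'rV[R]_n) (X : vfield M).

Let g_sym p := metric_symmx gM_metric p.
Let g_pos p : forall u, u != 0 -> 0 < (u *m gM p *m u^T) 0 0 :=
  metric_pos gM_metric p.
Let D_full p := rsub_rank F_sub p.

(** Around a point of the chart at a, the components of the projection are
    given by hproj_mx applied to the components of the metric and to the
    Jacobian matrix of F in the chart at a and the chart at the image b. *)
Lemma smooth_hproj : smooth_endo (fun p => proj_mx (hor F gM p) (vert F p)).
Proof.
move=> a; apply: smooth_on_local => x0 ax0.
pose b := F (cinv (chart_at a) x0); pose U := chart_preimage F a b.
have F_smooth := rsub_smooth F_sub.
have oU : open U by exact: open_chart_preimage.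
exists U; first by split=> //; exact: mem_chart_at.
pose q x := cinv (chart_at a) x.
pose J x := 'J (cmap (chart_at b) \o F \o cinv (chart_at a)) x.
pose C x := chart_change a (q x) (q x).
pose C' x := chart_change (q x) a (q x).
pose K x := chart_change (F (q x)) b (F (q x)).
pose g x := C x *m gM (q x) *m (C x)^T.
pose D x := dmap F (q x).
have qa x : U x -> cdom (chart_at a) (q x) by move=> [ax _]; exact: cinv_dom.
have JE x : U x -> J x = C x *m D x *m K x by exact: dmap_charts.
have uC x : U x -> C x \in unitmx.
  by move=> /qa aq; exact: chart_change_unitmx aq (mem_chart_at _).
have iC x : U x -> invmx (C x) = C' x.
  by move=> /qa aq; exact: invmx_chart_change aq (mem_chart_at _).
have uK x : U x -> K x \in unitmx.
  by move=> [_ bx]; exact: chart_change_unitmx (mem_chart_at _) bx.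
have ug x : gM (q x) \in unitmx by exact: metric_unitmx (g_pos (q x)).
have uG x : cogram (gM (q x)) (D x) \in unitmx.
  exact: cogram_unitmx (g_sym (q x)) (g_pos (q x)) (D_full (q x)).
have PE x : proj_mx (hor F gM (q x)) (vert F (q x)) = hproj_mx (gM (q x)) (D x).
  exact: proj_mx_hproj (g_sym (q x)) (g_pos (q x)) (D_full (q x)).
have sg : smooth_on U g.
  by move=> i; apply: Ck_on_subset (metric_smooth gM_metric a i) => x [].
have sJ : smooth_on U J.
  by apply: smooth_on_jacobian => //; exact: (proj2 F_smooth a b).
have ug' x : U x -> g x \in unitmx.
  by move=> Ux; rewrite !unitmx_mul unitmx_tr ug uC.
have uG' x : U x -> cogram (g x) (J x) \in unitmx.
  move=> Ux; rewrite (JE _ Ux) (cogram_basechange _ _ (ug x) (uC _ Ux)).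
  by rewrite !unitmx_mul unitmx_tr uK // uG.
apply: smooth_on_ext (smooth_on_hproj_mx oU sg sJ ug' uG') => // x Ux.
rewrite (JE _ Ux) (hproj_mx_basechange (ug x) (uC _ Ux) (uK _ Ux) (uG x)).
by rewrite (iC _ Ux) -PE.
Qed.

Lemma Hproj_add_Vproj X p : Hproj F gM X p + Vproj F gM X p = X p.
Proof.
rewrite /Hproj /Vproj addrC; apply: add_proj_mx.
  exact: ver_hor_cap (g_pos p).
have h := ver_hor_add (g_sym p) (g_pos p) (D_full p) (X p).
by rewrite /vert /hor /orth_compl /vert; exact: h.
Qed.

Lemma Hproj_hor X p : (Hproj F gM X p <= hor F gM p)%MS.
Proof. exact: proj_mx_sub. Qed.

Lemma Vproj_vert X p : (Vproj F gM X p <= vert F p)%MS.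
Proof. exact: proj_mx_sub. Qed.

Lemma Hproj_id X : (forall p, (X p <= hor F gM p)%MS) -> Hproj F gM X = X.
Proof.
move=> hX; apply/funext => p; apply: proj_mx_id => //.
exact: hor_ver_cap (g_pos p).
Qed.

Lemma Vproj_id X : (forall p, (X p <= vert F p)%MS) -> Vproj F gM X = X.
Proof.
move=> hX; apply/funext => p; apply: proj_mx_id => //.
exact: ver_hor_cap (g_pos p).
Qed.

Lemma Hproj_vert0 X :
  (forall p, (X p <= vert F p)%MS) -> Hproj F gM X = fun=> 0.
Proof.
move=> hX; apply/funext => p; apply: proj_mx_0 => //.
exact: hor_ver_cap (g_pos p).
Qed.

Lemma smooth_Hproj X : smooth_vf X -> smooth_vf (Hproj F gM X).
Proof. exact: smooth_vf_endo smooth_hproj. Qed.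

Lemma smooth_Vproj X : smooth_vf X -> smooth_vf (Vproj F gM X).
Proof.
move=> sX; have := smooth_vf_sub sX (smooth_Hproj sX).
congr smooth_vf; apply/funext => p /=.
by rewrite -[X in X - _]Hproj_add_Vproj addrC addKr.
Qed.

Lemma inner_hor_vert p u v :
  (u <= hor F gM p)%MS -> (v <= vert F p)%MS -> inner gM p u v = 0.
Proof.
move=> /sub_kermxP u0 /submxP[w ->].
by rewrite /inner trmx_mul mulmxA -(mulmxA u) u0 mul0mx mxE.
Qed.

(** The inner product is the squared norm of the vertical part of X. *)
Lemma hor_inner_vert p X :
  inner gM p (X p) (Vproj F gM X p) = 0 -> (X p <= hor F gM p)%MS.
Proof.
rewrite -{1}(Hproj_add_Vproj X p) innerDl.
rewrite (inner_hor_vert (Hproj_hor X p) (Vproj_vert X p)) add0r.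
move=> /(inner_eq0 gM_metric) V0.
by rewrite -(Hproj_add_Vproj X p) V0 addr0 Hproj_hor.
Qed.

(** Polarisation: a Riemannian submersion is only assumed to preserve
    lengths. *)
Lemma inner_dmap_hor p u v : (u <= hor F gM p)%MS -> (v <= hor F gM p)%MS ->
  inner gN (F p) (u *m dmap F p) (v *m dmap F p) = inner gM p u v.
Proof.
move=> hu hv; have iso := rsub_isometry F_sub.
have := iso p _ (addmx_sub hu hv).
rewrite mulmxDl !innerDl !innerDr !iso //.
rewrite (Defs.metric_sym gN_metric (F p) (v *m _)).
rewrite (Defs.metric_sym gM_metric p v u).
rewrite -!addrA => /addrI; rewrite !addrA => /addIr.
move=> two; apply: (@mulIf _ 2%:R); first by rewrite pnatr_eq0.
by rewrite !mulr_natr [LHS]mulr2n [RHS]mulr2n.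
Qed.

Lemma inner_Hproj p X w : (w <= hor F gM p)%MS ->
  inner gM p (Hproj F gM X p) w = inner gM p (X p) w.
Proof.
move=> hw; rewrite -[in RHS](Hproj_add_Vproj X p) innerDl.
rewrite (Defs.metric_sym gM_metric p (Vproj F gM X p)).
by rewrite (inner_hor_vert hw (Vproj_vert X p)) addr0.
Qed.

Lemma inner_push_hor X p v : (v <= hor F gM p)%MS ->
  inner gN (F p) (push F X p) (v *m dmap F p) = inner gM p (X p) v.
Proof.
move=> hv; rewrite /push -{1}(Hproj_add_Vproj X p) mulmxDl.
have V0 : Vproj F gM X p *m dmap F p = 0 by exact/sub_kermxP/Vproj_vert.
by rewrite V0 addr0 inner_dmap_hor ?Hproj_hor // inner_Hproj.
Qed.

End Submersion.

(** * Anti-invariant submersions of Kenmotsu manifolds *)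

Section Connections.
Variables (R : realType) (n k : nat) (M : manifold R n) (N : manifold R k).
Variable F : M -> N.

Lemma vf_app_cst (X : vfield M) (c : R) : vf_app X (fun=> c) = fun=> 0.
Proof. by apply/funext => p; rewrite /vf_app; exact: derive_cst. Qed.

Lemma connection0r (nabla : vfield M -> vfield M -> vfield M) X :
  affine_connection nabla -> smooth_vf X -> nabla X (fun=> 0) = fun=> 0.
Proof.
move=> cn sX; apply/funext => p.
have := conn_addr cn sX (@smooth_vf0 _ _ M) (@smooth_vf0 _ _ M).
have -> : (fun=> 0) \+ (fun=> 0) = (fun=> 0) :> vfield M.
  by apply/funext => q; rewrite /= addr0.
by move/(congr1 (@^~ p)) => /= /esym/eqP; rewrite -subr_eq0 addrK => /eqP.
Qed.

Lemma pullback_connection0r (nablaN : vfield N -> vfield N -> vfield N)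
    (nablaF : vfield M -> vfield_along F -> vfield_along F) X :
  pullback_connection nablaN nablaF -> smooth_vf X ->
  nablaF X (fun=> 0) = fun=> 0.
Proof.
move=> pc sX; apply/funext => p.
have s0 := @smooth_along0 _ _ _ _ _ F; have := pbc_addr pc sX s0 s0.
have -> : (fun=> 0) \+ (fun=> 0) = (fun=> 0) :> vfield_along F.
  by apply/funext => q; rewrite /= addr0.
by move/(congr1 (@^~ p)) => /= /esym/eqP; rewrite -subr_eq0 addrK => /eqP.
Qed.

End Connections.

Section KenmotsuSubmersion.
Variables (R : realType) (n k : nat) (M : manifold R n) (N : manifold R k).
Variables (phi : M -> 'M[R]_n) (xi : vfield M) (eta : M -> 'cV[R]_n).
Variables (gM : M -> 'M[R]_n) (nablaM : vfield M -> vfield M -> vfield M).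
Variables (gN : N -> 'M[R]_k) (nablaN : vfield N -> vfield N -> vfield N).
Variable F : M -> N.
Variable nablaF : vfield M -> vfield_along F -> vfield_along F.
Hypothesis M_kenmotsu : kenmotsu phi xi eta gM nablaM.
Hypothesis gN_metric : riemannian_metric gN.
Hypothesis F_sub : riemannian_submersion F gM gN.
Hypothesis nablaF_pullback : pullback_connection nablaN nablaF.
Hypothesis F_anti : anti_invariant F phi gM.
Hypothesis xi_hor : forall p, (xi p <= hor F gM p)%MS.

Let acm := kenmotsu_acm M_kenmotsu.
Let gM_metric := acm_metric acm.
Let conn := lc_connection (kenmotsu_lc M_kenmotsu).

Let B := Bpart F gM phi.
Let C := Cpart F gM phi.
Let A := oneillA F gM nablaM.

Let sphi X : smooth_vf X -> smooth_vf (endo phi X).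
Proof. exact: smooth_vf_endo (acm_phi_smooth acm). Qed.

Let sB X : smooth_vf X -> smooth_vf (B X).
Proof. by move=> /sphi; exact: smooth_Vproj gM_metric F_sub _. Qed.

Let sC X : smooth_vf X -> smooth_vf (C X).
Proof. by move=> /sphi; exact: smooth_Hproj gM_metric F_sub _. Qed.

Lemma eta_vert p v : (v <= vert F p)%MS -> Defs.form eta p v = 0.
Proof.
move=> hv; rewrite (acm_eta_g acm) (Defs.metric_sym gM_metric).
exact: inner_hor_vert (xi_hor p) hv.
Qed.

Lemma inner_phi_vert p u v : (v <= vert F p)%MS ->
  inner gM p (u *m phi p) (v *m phi p) = inner gM p u v.
Proof. by move=> hv; rewrite (acm_compat acm) (eta_vert hv) mulr0 subr0. Qed.

Lemma endo_BC Y : endo phi Y = B Y \+ C Y.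
Proof.
apply/funext => p; rewrite /= addrC; apply/esym.
exact: (Hproj_add_Vproj gM_metric F_sub).
Qed.

Lemma CE Y p : C Y p = Y p *m phi p - B Y p.
Proof. by rewrite -[Y p *m _]/(endo phi Y p) endo_BC /= addrC addKr. Qed.

(** This is the statement that C takes values in mu. *)
Lemma inner_C_phi_vert Y p v : (Y p <= hor F gM p)%MS -> (v <= vert F p)%MS ->
  inner gM p (C Y p) (v *m phi p) = 0.
Proof.
move=> hY hv; rewrite CE innerBl (inner_phi_vert _ hv) (inner_hor_vert hY hv).
rewrite (Defs.metric_sym gM_metric).
by rewrite (inner_hor_vert (F_anti hv) (Vproj_vert _ _ _ _)) subr0.
Qed.

Lemma inner_C_xi Y p : inner gM p (C Y p) (xi p) = 0.
Proof.
rewrite -(acm_eta_g acm) CE /Defs.form mulmxBl mxE [X in _ + X]mxE.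
rewrite -!/(Defs.form _ _ _) (acm_eta_phi acm) (eta_vert (Vproj_vert _ _ _ _)).
by rewrite subr0.
Qed.

(** The other half of A_X Z is the vertical part of nabla_X 0. *)
Lemma oneillA_vert X Z : section_of (hor F gM) X ->
  (forall p, (Z p <= vert F p)%MS) -> A X Z = Hproj F gM (nablaM X Z).
Proof.
move=> [sX hX] hZ; rewrite /A /oneillA.
rewrite (Hproj_id gM_metric hX) (Hproj_vert0 gM_metric hZ).
rewrite (Vproj_id gM_metric hZ) (connection0r conn sX).
by apply/funext => p; rewrite /= /Vproj mul0mx add0r.
Qed.

(** Here main moves the left-hand side from Y to phi Y by the Kenmotsu
    equation, leib is the derivative of CV0, and CV is the Kenmotsu equation
    for V. *)
Lemma inner_nabla_vert X Y V p :
  section_of (hor F gM) X -> section_of (hor F gM) Y -> section_of (vert F) V ->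
  inner gM p (nablaM X Y p) (V p) =
    inner gM p (A X (B Y) p) (endo phi V p) -
    inner gM p (C Y p) (endo phi (A X V) p).
Proof.
move=> hX hY hV; have [sX X_hor] := hX; have [sY Y_hor] := hY.
have [sV V_vert] := hV; have vV := V_vert p.
have W_hor : (endo phi V p <= hor F gM p)%MS by exact: F_anti.
have xi_W : inner gM p (xi p) (endo phi V p) = 0.
  by rewrite (Defs.metric_sym gM_metric) -(acm_eta_g acm) (acm_eta_phi acm).
have AXB : inner gM p (A X (B Y) p) (endo phi V p) =
           inner gM p (nablaM X (B Y) p) (endo phi V p).
  have vB q : (B Y q <= vert F q)%MS by exact: Vproj_vert.
  by rewrite (oneillA_vert hX vB) (inner_Hproj gM_metric F_sub _ W_hor).
have main : inner gM p (nablaM X Y p) (V p) =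
    inner gM p (nablaM X (endo phi Y) p) (endo phi V p).
  apply: etrans (esym (inner_phi_vert (nablaM X Y p) vV)) _.
  have XV : inner gM p (endo phi X p) (endo phi V p) = 0.
    exact: etrans (inner_phi_vert (X p) vV) (inner_hor_vert (X_hor p) vV).
  have := kenmotsu_nabla M_kenmotsu sX sY p.
  move/(congr1 (fun u => inner gM p u (endo phi V p))).
  rewrite !innerBl !innerZl xi_W XV !mulr0 subr0 => /eqP.
  by rewrite subr_eq0 => /eqP ->.
have CV0 : (fun q => inner gM q (C Y q) (endo phi V q)) = fun=> 0.
  by apply/funext => q; exact: (inner_C_phi_vert (Y_hor q) (V_vert q)).
have := lc_metric (kenmotsu_lc M_kenmotsu) sX (sC sY) (sphi sV) p.
rewrite CV0 vf_app_cst => /esym/eqP; rewrite addr_eq0 => /eqP leib.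
have CV : inner gM p (C Y p) (nablaM X (endo phi V) p) =
          inner gM p (C Y p) (endo phi (A X V) p).
  have := kenmotsu_nabla M_kenmotsu sX sV p.
  rewrite (eta_vert vV) scale0r subr0 => /eqP; rewrite subr_eq => /eqP ->.
  rewrite innerDr innerZr inner_C_xi mulr0 add0r (oneillA_vert hX V_vert).
  rewrite {1}/endo -(Hproj_add_Vproj gM_metric F_sub (nablaM X V) p).
  rewrite mulmxDl innerDr.
  have v0 := inner_C_phi_vert (Y_hor p) (Vproj_vert F gM (nablaM X V) p).
  by rewrite [X in _ + X]v0 addr0.
rewrite main AXB endo_BC (conn_addr conn) //; [|exact: sB|exact: sC].
by rewrite [(_ \+ _) p]/= innerDl leib CV.
Qed.

Lemma inner_lie_bracket_vert X Y V p :
  section_of (hor F gM) X -> section_of (hor F gM) Y -> section_of (vert F) V ->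
  inner gM p (lie_bracket X Y p) (V p) =
    inner gM p (A X (B Y) p - A Y (B X) p) (endo phi V p) -
    (inner gM p (C Y p) (endo phi (A X V) p) -
     inner gM p (C X p) (endo phi (A Y V) p)).
Proof.
move=> hX hY hV; rewrite -(lc_torsion_free (kenmotsu_lc M_kenmotsu)).
- rewrite [(_ \- _) p]/= !innerBl !inner_nabla_vert //; lra.
- by case: hX.
- by case: hY.
Qed.

(** Only the term - F_* (nabla_X Z) of the second fundamental form is
    left, as F_* Z = 0. *)
Lemma inner_sff_vert X Z V p :
  section_of (hor F gM) X -> section_of (vert F) Z -> section_of (vert F) V ->
  inner gN (F p) (second_fundamental_form nablaM nablaF X Z p)
    (push F (endo phi V) p) = - inner gM p (A X Z p) (endo phi V p).
Proof.
move=> hX [sZ vZ] [sV vV]; have [sX _] := hX.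
have W_hor : (endo phi V p <= hor F gM p)%MS by exact: F_anti.
have pushZ : push F Z = fun=> 0.
  by apply/funext => q; exact/sub_kermxP/vZ.
rewrite /second_fundamental_form pushZ.
rewrite (pullback_connection0r nablaF_pullback sX).
rewrite [(_ \- _) p]/= sub0r innerNl.
rewrite (inner_push_hor gM_metric gN_metric F_sub _ W_hor).
by rewrite (oneillA_vert hX vZ) (inner_Hproj gM_metric F_sub _ W_hor).
Qed.

Lemma section_B X : smooth_vf X -> section_of (vert F) (B X).
Proof. by move=> sX; split=> [|p]; [exact: sB|exact: Vproj_vert]. Qed.

(** For the converse, the test field V is the vertical part of [X, Y].
    That it is smooth follows from [X, Y] = nabla_X Y - nabla_Y X. *)
Lemma integrable_horP : integrable_distribution (hor F gM) <->
  forall X Y V, section_of (hor F gM) X -> section_of (hor F gM) Y ->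
    section_of (vert F) V -> forall p,
    inner gM p (lie_bracket X Y p) (V p) = 0.
Proof.
split=> [int X Y V hX hY [sV vV] p|orth X Y hX hY p].
  exact: inner_hor_vert (int _ _ hX hY p) (vV p).
apply: (hor_inner_vert gM_metric F_sub); apply: orth => //.
split=> [|q]; last exact: Vproj_vert.
apply: (smooth_Vproj gM_metric F_sub).
have [[sX _] [sY _]] := (hX, hY).
rewrite -(lc_torsion_free (kenmotsu_lc M_kenmotsu) sX sY).
by apply: smooth_vf_sub; exact: conn_smooth.
Qed.

End KenmotsuSubmersion.
Theorem theorem2 (R : realType) (m k : nat)
    (M : manifold R (2 * m).+1) (N : manifold R k)
    (phi : M -> 'M[R]_((2 * m).+1)) (xi : vfield M)
    (eta : M -> 'cV[R]_((2 * m).+1)) (gM : M -> 'M[R]_((2 * m).+1))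
    (nablaM : vfield M -> vfield M -> vfield M)
    (gN : N -> 'M[R]_k) (nablaN : vfield N -> vfield N -> vfield N)
    (F : M -> N)
    (nablaF : vfield M -> vfield_along F -> vfield_along F)
    (M_connected : connected [set: M])
    (M_kenmotsu : kenmotsu phi xi eta gM nablaM)
    (gN_metric : riemannian_metric gN)
    (nablaN_lc : levi_civita gN nablaN)
    (F_submersion : riemannian_submersion F gM gN)
    (nablaF_pullback : pullback_connection nablaN nablaF)
    (F_anti_invariant : anti_invariant F phi gM)
    (xi_horizontal : forall p, (xi p <= hor F gM p)%MS) :
  let B := Bpart F gM phi in
  let C := Cpart F gM phi in
  let A := oneillA F gM nablaM in
  let S := second_fundamental_form nablaM nablaF in
  [<-> integrable_distribution (hor F gM);

       forall X Y V, section_of (hor F gM) X -> section_of (hor F gM) Y ->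
         section_of (vert F) V -> forall p,
         inner gN (F p) (S Y (B X) p) (push F (endo phi V) p) =
         inner gN (F p) (S X (B Y) p) (push F (endo phi V) p)
         + inner gM p (C Y p) (endo phi (A X V) p)
         - inner gM p (C X p) (endo phi (A Y V) p);

       forall X Y V, section_of (hor F gM) X -> section_of (hor F gM) Y ->
         section_of (vert F) V -> forall p,
         inner gM p (A X (B Y) p - A Y (B X) p) (endo phi V p) =
         inner gM p (C Y p) (endo phi (A X V) p)
         - inner gM p (C X p) (endo phi (A Y V) p)].
Proof.
move=> B C A S.
have br := inner_lie_bracket_vert M_kenmotsu F_submersion F_anti_invariant
  xi_horizontal.
have sff := inner_sff_vert M_kenmotsu gN_metric F_submersion nablaF_pullback
  F_anti_invariant.
have secB X := section_B M_kenmotsu F_submersion (X := X).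
have intP := integrable_horP M_kenmotsu F_submersion.
tfae.
- move=> /intP int X Y V hX hY hV p; have [[sX _] [sY _]] := (hX, hY).
  rewrite /S /B !sff //; [|exact: secB|exact: secB].
  have := br X Y V p hX hY hV; rewrite int // innerBl /A /B /C; lra.
- move=> h X Y V hX hY hV p; have [[sX _] [sY _]] := (hX, hY).
  have := h X Y V hX hY hV p.
  rewrite /S /B !sff //; [|exact: secB|exact: secB].
  rewrite innerBl /A /B /C; lra.
- move=> h; apply/intP => X Y V hX hY hV p.
  by rewrite br //; apply/eqP; rewrite subr_eq0; apply/eqP; exact: h.
Qed.
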